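(* In generalized non-signalling theory (box world), every bipartite entropy vector $(\hat H(X),\hat H(Y),\hat H(XY))$ (with $X$, $Y$ systems of finitely many boxes and the state any state of $XY$) lies in the closure of the set of entropy vectors $(\hat H(X),\hat H(Y),\hat H(XY))$ of separable states of such bipartite systems.
   Context: Box world (GNST): a box has a finite set of inputs and outputs. A system of boxes has states given by all collections $p(\mathbf{a}|\mathbf{x})\ge0$ (output tuple $\mathbf{a}$, input tuple $\mathbf{x}$) that are normalized ($\sum_{\mathbf{a}}p(\mathbf{a}|\mathbf{x})=1$) and no-signalling (for each box $i$, $\sum_{a_i}p(\mathbf{a}|\mathbf{x})$ is independent of $x_i$); reduced states are obtained by summing out the outputs of the discarded boxes. A state of $XY$ is separable if it has the form $p(\mathbf{a},\mathbf{b}|\mathbf{x},\mathbf{y})=\sum_i w_i\,q_i(\mathbf{a}|\mathbf{x})\,r_i(\mathbf{b}|\mathbf{y})$ with finitely many probability weights $w_i\ge0$, $\sum_i w_i=1$, and states $q_i$ of $X$ and $r_i$ of $Y$. An effect is any linear map from states to $[0,1]$; a measurement is a finite set $\{(r,\mu_r)\}$ of effects summing to the constant map $1$ (all such are allowed). A measurement $N=\{(s,\nu_s)\}$ refines $M=\{(r,\mu_r)\}$ if the outcomes of $N$ can be partitioned into sets $P_r$ with $\mu_r=\sum_{s\in P_r}\nu_s$; the refinement is trivial if $\nu_s\propto\mu_r$ whenever $s\in P_r$; $M$ is maximally informative if it has no non-trivial refinement. The measurement entropy of a system $Z$ in state $\mathbf{p}$ is $\hat H(Z)=\inf_M H_M(Z)$,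 the infimum over maximally informative measurements $M$ on $Z$ of the Shannon entropy (base 2) of the outcome distribution $(\mu_r(\mathbf{p}))_r$. *)

(* Defs.v *)
From HB Require Import structures.
From mathcomp Require Import all_boot all_order all_algebra.
From mathcomp Require Import boolp classical_sets reals topology normedtype exp.
Import numFieldNormedType.Exports.
Set Implicit Arguments. Unset Strict Implicit. Unset Printing Implicit Defensive.
Import Order.TTheory GRing.Theory Num.Theory.
Local Open Scope ring_scope.

(* A system of finitely many boxes: a finite type of boxes; box [b] has
   input set 'I_(nin b).+1 and output set 'I_(nout b).+1 (finite, nonempty). *)
Record system := Sys { box : finType; nin : box -> nat; nout : box -> nat }.

Definition outs (S : system) : finType := {dffun forall b : box S, 'I_(@nout S b).+1}.
Definition ins (S : system) : finType := {dffun forall b : box S, 'I_(@nin S b).+1}.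

Section BoxWorld.
Variable R : realType.
Variable S : system.

Definition is_state (p : outs S -> ins S -> R) : Prop :=
  [/\ forall a x, 0 <= p a x,
      forall x, \sum_(a : outs S) p a x = 1 &
      forall (b : box S) (x x' : ins S),
        (forall b', b' != b -> x b' = x' b') ->
        forall a : outs S,
          \sum_(a' : outs S | [forall b', (b' != b) ==> (a' b' == a b')]) p a' x =
          \sum_(a' : outs S | [forall b', (b' != b) ==> (a' b' == a b')]) p a' x'].

(* a linear functional on the (finite-dimensional) space containing the states,
   given by its coefficients *)
Definition eff (c : outs S -> ins S -> R) (p : outs S -> ins S -> R) : R :=
  \sum_(a : outs S) \sum_(x : ins S) c a x * p a x.

Definition is_effect (c : outs S -> ins S -> R) : Prop :=
  forall p, is_state p -> 0 <= eff c p <= 1.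

Definition is_meas n (M : 'I_n -> outs S -> ins S -> R) : Prop :=
  (forall r, is_effect (M r)) /\
  (forall p, is_state p -> \sum_(r < n) eff (M r) p = 1).

(* N refines M via the partition of outcomes of N given by f (P_r = f^-1 r);
   effects are compared as maps on states *)
Definition refines_via n' n (N : 'I_n' -> outs S -> ins S -> R)
    (M : 'I_n -> outs S -> ins S -> R) (f : 'I_n' -> 'I_n) : Prop :=
  forall r p, is_state p -> eff (M r) p = \sum_(s < n' | f s == r) eff (N s) p.

Definition trivial_via n' n (N : 'I_n' -> outs S -> ins S -> R)
    (M : 'I_n -> outs S -> ins S -> R) (f : 'I_n' -> 'I_n) : Prop :=
  forall s, exists c : R, forall p, is_state p -> eff (N s) p = c * eff (M (f s)) p.

Definition max_informative n (M : 'I_n -> outs S -> ins S -> R) : Prop :=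
  is_meas M /\
  forall n' (N : 'I_n' -> outs S -> ins S -> R) (f : 'I_n' -> 'I_n),
    is_meas N -> refines_via N M f -> trivial_via N M f.

Definition negxlog2 (q : R) : R := if q == 0 then 0 else - (q * (ln q / ln 2)).

Definition H_M n (M : 'I_n -> outs S -> ins S -> R) (p : outs S -> ins S -> R) : R :=
  \sum_(r < n) negxlog2 (eff (M r) p).

Definition Hhat (p : outs S -> ins S -> R) : R :=
  inf [set h | exists n (M : 'I_n -> outs S -> ins S -> R),
                 max_informative M /\ h = H_M M p].

End BoxWorld.

Definition compose (X Y : system) : system :=
  @Sys (box X + box Y)%type
    (fun b => match b with inl x => @nin X x | inr y => @nin Y y end)
    (fun b => match b with inl x => @nout X x | inr y => @nout Y y end).

Definition joinO (X Y : system) (a : outs X) (b : outs Y) : outs (compose X Y) :=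
  finfun (fun z => match z as z0 return 'I_(@nout (compose X Y) z0).+1 with
                   | inl x => a x | inr y => b y end).

Definition joinI (X Y : system) (x : ins X) (y : ins Y) : ins (compose X Y) :=
  finfun (fun z => match z as z0 return 'I_(@nin (compose X Y) z0).+1 with
                   | inl u => x u | inr v => y v end).

Definition ins0 (S : system) : ins S := finfun (fun b => ord0).

Section Composite.
Variable R : realType.
Variables X Y : system.

(* reduced states (summing out the outputs of the discarded boxes; the inputs of
   the discarded boxes are irrelevant by no-signalling, we fix them to 0) *)
Definition redX (p : outs (compose X Y) -> ins (compose X Y) -> R) :
    outs X -> ins X -> R :=
  fun a x => \sum_(b : outs Y) p (joinO a b) (joinI x (ins0 Y)).

Definition redY (p : outs (compose X Y) -> ins (compose X Y) -> R) :
    outs Y -> ins Y -> R :=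
  fun b y => \sum_(a : outs X) p (joinO a b) (joinI (ins0 X) y).

Definition entvec (p : outs (compose X Y) -> ins (compose X Y) -> R) : R * R * R :=
  (Hhat (redX p), Hhat (redY p), Hhat p).

Definition separable (p : outs (compose X Y) -> ins (compose X Y) -> R) : Prop :=
  exists n (w : 'I_n -> R) (q : 'I_n -> outs X -> ins X -> R)
           (r : 'I_n -> outs Y -> ins Y -> R),
    [/\ forall i, 0 <= w i, \sum_(i < n) w i = 1,
        forall i, is_state (q i), forall i, is_state (r i) &
        forall a b x y, p (joinO a b) (joinI x y) = \sum_(i < n) w i * q i a x * r i b y].

End Composite.

Definition sep_entropy_vectors (R : realType) : set (R * R * R) :=
  [set v | exists (X Y : system) (p : outs (compose X Y) -> ins (compose X Y) -> R),
             is_state p /\ separable p /\ v = entvec p].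

(* Main.v *)
Require Import Defs.
From HB Require Import structures.
From mathcomp Require Import all_boot all_order all_algebra.
From mathcomp Require Import boolp classical_sets reals topology normedtype exp.
From mathcomp Require Import sequences ring lra zify.
Import numFieldNormedType.Exports.
Set Implicit Arguments. Unset Strict Implicit. Unset Printing Implicit Defensive.
Import Order.TTheory GRing.Theory Num.Theory.
Local Open Scope ring_scope.

(* The entropies of any state satisfy 0 <= H(X), H(Y), H(XY) and
   H(XY) <= H(X) + H(Y), and separable states come arbitrarily close to every
   vector satisfying these inequalities.

   By Farkas' lemma every effect is a nonnegative combination of the elementary
   effects p |-> p(a|x), and these are extremal; so the outcomes of a maximally
   informative measurement are multiples of elementary effects.  Hence products of
   maximally informative measurements are maximally informative, and Shannon
   subadditivity gives H(XY) <= H(X) + H(Y).  Also, if an unnormalised state g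
   satisfies g(a|x) <= - p(a|x) log p(a|x) pointwise, then H(p) is at least the
   norm of g.

   For the converse each party holds two boxes.  Two hidden bits are 1 with a small
   probability e.  The second box of each party outputs 0 or, if its own bit is 1,
   a uniform element of [1..m]; the first box outputs 0 if its input equals the bit
   of the other party and a uniform element of [1..N] otherwise.  The joint system
   is measured by reading the second boxes first and feeding the bits that they
   reveal to the first boxes, so N costs nothing there, while locally it costs
   about e log N.  As e tends to 0 with e log N and e log m fixed, the entropies of
   the bits vanish. *)

(** * Farkas' lemma *)

(** Linearity is demanded only on [L] and only for the combination that a projection along a vector
    produces, so [L] need not carry a vector space structure. *)
Definition scalar_on (R : realFieldType) (T : Type) (L : (T -> R) -> Prop)
    (g : (T -> R) -> R) : Prop :=
  forall k p q, L p -> L q -> g (fun t => p t - k * q t) = g p - k * g q.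

(* Bartl's induction on the number of functionals: if the last one, [al i0], is
   needed, project along a vector [z] violating the conclusion onto its kernel. *)
Lemma farkas (R : realFieldType) (T : Type) (L : (T -> R) -> Prop)
    (I : eqType) (s : seq I) (al : I -> (T -> R) -> R) (ga : (T -> R) -> R) :
  (forall k p q, L p -> L q -> L (fun t => p t - k * q t)) ->
  uniq s -> (forall i, scalar_on L (al i)) -> scalar_on L ga ->
  (forall x, L x -> (forall i, i \in s -> 0 <= al i x) -> 0 <= ga x) ->
  exists2 u : I -> R, forall i, 0 <= u i &
    forall x, L x -> ga x = \sum_(i <- s) u i * al i x.
Proof.
move=> LB; elim: s al ga => [|i0 s IHs] al ga /=.
  move=> _ _ gaL ga0; exists (fun=> 0) => // x Lx; rewrite big_nil.
  (* The factor 2 turns [x] into [- x]; [ga] is nonnegative on both, hence zero. *)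
  have := ga0 _ (LB 2 _ _ Lx Lx) (fun _ => ltac:(done)).
  have := ga0 _ Lx (fun _ => ltac:(done)).
  rewrite gaL //; lra.
move=> /andP[i0s us] alL gaL ga0.
have [h|/existsNP[z /not_implyP[Lz /not_implyP[alz /negP]]]] := pselect (forall x, L x ->
    (forall i, i \in s -> 0 <= al i x) -> 0 <= ga x).
  have [u u0 uE] := IHs al ga us alL gaL h.
  exists (fun i => if i == i0 then 0 else u i) => [i|x Lx]; first by case: eqP.
  rewrite big_cons eqxx mul0r add0r uE //; apply: eq_big_seq => i si.
  by case: eqP si i0s => // -> ->.
rewrite -ltNge => gaz.
have k0 : al i0 z < 0.
  rewrite ltNge; apply/negP => alz0; move: gaz; rewrite ltNge ga0 // => i.
  by rewrite inE => /predU1P[->//|]; apply: alz.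
have kN : al i0 z != 0 by rewrite lt_eqF.
(* [proj f] is [f] after the projection along [z] onto the kernel of [al i0]. *)
pose proj (f : (T -> R) -> R) x := f x - al i0 x / al i0 z * f z.
have projL f : scalar_on L f -> scalar_on L (proj f).
  by move=> fL k p q Lp Lq; rewrite /proj fL // alL //; field.
have [||x Lx alx|u u0 uE] := IHs (fun i => proj (al i)) (proj ga) us.
- by move=> i; apply: projL.
- exact: projL.
- rewrite /proj -gaL //; apply: ga0; first exact: LB.
  move=> i; rewrite inE alL // => /predU1P[->|si]; last exact: alx.
  by rewrite divfK // subrr.
(* The coefficient of [al i0] left over when the projected identity is expanded. Numerator and
   denominator are both negative. *)
pose c := (ga z - \sum_(i <- s) u i * al i z) / al i0 z.
exists (fun i => if i == i0 then c else u i) => [i|x Lx].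
  case: eqP => // _; rewrite /c -mulrNN -invrN mulr_ge0 //.
    rewrite oppr_ge0 subr_le0 (le_trans (ltW gaz)) // big_seq sumr_ge0 // => j sj.
    by rewrite mulr_ge0 // alz.
  by rewrite invr_ge0 oppr_ge0 ltW.
have {uE} := uE x Lx; rewrite {1}/proj => /eqP; rewrite subr_eq => /eqP ->.
rewrite big_cons eqxx.
rewrite [X in X + _ = _](_ : _ = \sum_(i <- s) (u i * al i x - al i0 x / al i0 z * (u i * al i z))); last first.
  by apply: eq_bigr => i _; rewrite mulrBr mulrCA.
rewrite sumrB -mulr_sumr /c.
rewrite [X in _ = _ + X](_ : _ = \sum_(i <- s) u i * al i x); first by field.
by apply: eq_big_seq => i si; case: eqP si i0s => // -> ->.
Qed.

(** * States and no-signalling *)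

Definition agree_off (B : eqType) (T : B -> Type) (b : B) (a1 a2 : forall b, T b) :=
  forall b', b' != b -> a1 b' = a2 b'.

Section States.
Variables (R : realType) (S : system).
Implicit Types (p q : outs S -> ins S -> R) (a : outs S) (x : ins S).

(* No-signalling in dual form: changing the input of a box does not change the
   expectation of a function that ignores the output of this box. *)
Definition nosig p := forall b x x', agree_off b x x' ->
  forall f : outs S -> R, (forall a1 a2, agree_off b a1 a2 -> f a1 = f a2) ->
  \sum_a f a * p a x = \sum_a f a * p a x'.

(** The norm [k] is kept explicit so that multiples, sums and slices of states can be tracked. *)
Definition ustate (k : R) p :=
  [/\ forall a x, 0 <= p a x, forall x, \sum_a p a x = k & nosig p].

(** A sum over the outputs that agree with [a] off [b] is the expectation of an indicator;
    conversely, a function ignoring the output of [b] is constant on each such class. *)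
Lemma nosigP p : nosig p <-> forall (b : box S) (x x' : ins S),
    (forall b', b' != b -> x b' = x' b') ->
    forall a : outs S,
      \sum_(a' : outs S | [forall b', (b' != b) ==> (a' b' == a b')]) p a' x =
      \sum_(a' : outs S | [forall b', (b' != b) ==> (a' b' == a b')]) p a' x'.
Proof.
split=> ns b x x' xx'.
  move=> a; pose f a' : R := [forall b', (b' != b) ==> (a' b' == a b')]%:R.
  have fE y : \sum_(a' : outs S | [forall b', (b' != b) ==> (a' b' == a b')]) p a' y =
      \sum_a' f a' * p a' y.
    rewrite big_mkcond /=; apply: eq_bigr => a' _; rewrite /f.
    by case: ifP => _; rewrite ?mul1r ?mul0r.
  rewrite !fE; apply: (ns b x x' xx' f) => a1 a2 a12; rewrite /f; congr (nat_of_bool _)%:R.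
  apply: eq_forallb => b'; case: (boolP (b' == b)) => //= b'b.
  by rewrite a12.
move=> f fb.
(* [rs] resets the output of [b], which picks a representative of each class. *)
pose rs a : outs S := finfun (fun b' => if b' == b then ord0 else a b').
have rsK a : rs (rs a) = rs a.
  by apply/ffunP => b'; rewrite !ffunE; case: (b' == b).
have rsE a c : rs c = c -> (rs a == c) = [forall b', (b' != b) ==> (a b' == c b')].
  move=> <-; apply/eqP/forallP => [<- b'|ac].
    by apply/implyP => /negPf b'b; rewrite !ffunE b'b.
  apply/ffunP => b'; rewrite !ffunE; case: ifPn => // b'b.
  by have := ac b'; rewrite b'b /= !ffunE (negPf b'b) => /eqP.
rewrite (partition_big rs xpredT) //= [RHS](partition_big rs xpredT) //=.
apply: eq_bigr => c _; have [rc|/eqP rc] := eqVneq (rs c) c; last first.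
  rewrite !big_pred0 // => a; apply/negbTE; apply/eqP => ac; apply: rc;
  by rewrite -ac rsK.
have sE y : \sum_(a | rs a == c) f a * p a y = f c *
    \sum_(a' : outs S | [forall b', (b' != b) ==> (a' b' == c b')]) p a' y.
  rewrite mulr_sumr; apply: eq_big => [a|a]; first by rewrite rsE.
  rewrite rsE // => /forallP ac; congr (_ * _); apply: fb => b' b'b.
  by have := ac b'; rewrite b'b /= => /eqP.
by rewrite !sE (ns b x x').
Qed.

Lemma is_stateE p : is_state p <-> ustate 1 p.
Proof. by split=> -[p0 p1 /nosigP ns]; split. Qed.

(** The inputs are changed one box at a time through the hybrids [hyb s]; only boxes where [x] and
    [x'] differ constrain [f]. *)
Lemma nosig_sum p x x' (f : outs S -> R) : nosig p ->
  (forall b, x b != x' b -> forall a1 a2, agree_off b a1 a2 -> f a1 = f a2) ->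
  \sum_a f a * p a x = \sum_a f a * p a x'.
Proof.
move=> ns fb.
pose hyb (s : seq (box S)) : ins S := finfun (fun b => if b \in s then x' b else x b).
have hE s : \sum_a f a * p a x = \sum_a f a * p a (hyb s).
  elim: s => [|b s ->].
    by suff -> : hyb [::] = x by []; apply/ffunP => b; rewrite ffunE.
  have [xb|xb] := eqVneq (x b) (x' b).
    suff -> : hyb (b :: s) = hyb s by [].
    apply/ffunP => b'; rewrite !ffunE inE.
    by case: eqVneq => //= ->; rewrite xb if_same.
  apply: (ns b) (fb b xb) => b' b'b; rewrite !ffunE inE (negPf b'b) //.
suff -> : x' = hyb (enum (box S)) by apply: hE.
by apply/ffunP => b; rewrite ffunE mem_enum.
Qed.

(** Local deterministic strategies; they serve as test states. *)
Definition detstate (phi : forall b : box S, 'I_(@nin S b).+1 -> 'I_(@nout S b).+1) :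
    outs S -> ins S -> R :=
  fun a x => (a == finfun (fun b => phi b (x b)))%:R.

Lemma sum_delta (T : finType) (a0 : T) (F : T -> R) :
  \sum_a F a * (a == a0)%:R = F a0.
Proof.
rewrite (bigD1 a0) //= eqxx mulr1 big1 ?addr0 // => a /negPf ->.
by rewrite mulr0.
Qed.

Lemma detstate_ustate phi : ustate 1 (detstate phi).
Proof.
split=> [a x|x|b x x' xx' f fb]; first exact: ler0n.
  rewrite -(sum_delta (finfun (fun b => phi b (x b)) : outs S) (fun=> 1)).
  by apply: eq_bigr => a _; rewrite mul1r.
rewrite !sum_delta; apply: fb => b' b'b; rewrite !ffunE xx' //.
Qed.

Lemma exists_state a x : exists2 p : outs S -> ins S -> R, is_state p & p a x = 1.
Proof.
exists (detstate (fun b _ => a b)); first exact/is_stateE/detstate_ustate.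
rewrite /detstate (_ : finfun _ = a) ?eqxx //.
by apply/ffunP => b; rewrite ffunE.
Qed.

Lemma ustateZ k c p : 0 <= c -> ustate k p -> ustate (c * k) (fun a x => c * p a x).
Proof.
move=> c0 [p0 p1 ns]; split=> [a x|x|b x x' xx' f fb].
- exact: mulr_ge0.
- by rewrite -mulr_sumr p1.
- by under eq_bigr do rewrite mulrCA; under [RHS]eq_bigr do rewrite mulrCA;
  rewrite -!mulr_sumr (ns _ _ _ xx').
Qed.

Lemma ustateD k l p q : ustate k p -> ustate l q ->
  ustate (k + l) (fun a x => p a x + q a x).
Proof.
move=> [p0 p1 pns] [q0 q1 qns]; split=> [a x|x|b x x' xx' f fb].
- exact: addr_ge0.
- by rewrite big_split /= p1 q1.
- by under eq_bigr do rewrite mulrDr; under [RHS]eq_bigr do rewrite mulrDr;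
  rewrite !big_split /= (pns _ _ _ xx') // (qns _ _ _ xx').
Qed.

Lemma ustate_ext k l p q : k = l -> (forall a x, p a x = q a x) ->
  ustate k p -> ustate l q.
Proof.
by move=> -> pq; rewrite (_ : p = q) //; apply/funext => a; apply/funext => x.
Qed.

Lemma ustate_sum (T : finType) (k : T -> R) (p : T -> outs S -> ins S -> R) :
  (forall t, ustate (k t) (p t)) ->
  ustate (\sum_t k t) (fun a x => \sum_t p t a x).
Proof.
move=> H; elim: (index_enum T) => [|t s IHs].
  apply: (@ustate_ext (0 * 1) _ (fun a x => 0 * detstate (fun _ _ => ord0) a x)).
  - by rewrite big_nil mul0r.
  - by move=> a x; rewrite big_nil mul0r.
  - by apply: ustateZ => //; apply: detstate_ustate.
apply: (ustate_ext _ _ (ustateD (H t) IHs)); first by rewrite big_cons.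
by move=> a x; rewrite big_cons.
Qed.

Lemma ustate_scale k p : ustate k p ->
  exists2 q : outs S -> ins S -> R, is_state q & forall a x, p a x = k * q a x.
Proof.
(* For [k = 0] nonnegativity forces [p] to vanish, and any state serves as [q]. *)
move=> pk; have [k0|kN0] := eqVneq k 0.
  have [q q1 _] := exists_state (finfun (fun=> ord0)) (ins0 S).
  exists q => // a x; move: pk => [p0 p1 _]; rewrite k0 mul0r.
  by move: (p1 x); rewrite k0 => /psumr_eq0P; apply.
have k0 : 0 <= k by have [p0 p1 _] := pk; rewrite -(p1 (ins0 S)) sumr_ge0.
exists (fun a x => k^-1 * p a x); last by move=> a x; rewrite mulVKf.
apply/is_stateE; apply: (ustate_ext _ _ (ustateZ _ pk)) => //; last by rewrite invr_ge0.
by rewrite mulVf.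
Qed.

End States.

(** * Effects and maximally informative measurements *)

Section Measurements.
Variables (R : realType) (S : system).
Implicit Types (p q : outs S -> ins S -> R) (a : outs S) (x : ins S).

Lemma effZr (c : outs S -> ins S -> R) k p :
  eff c (fun a x => k * p a x) = k * eff c p.
Proof.
rewrite mulr_sumr; apply: eq_bigr => a _; rewrite mulr_sumr.
by apply: eq_bigr => x _; rewrite mulrCA.
Qed.

Definition unit_effect (c : R) (a0 : outs S) (x0 : ins S) : outs S -> ins S -> R :=
  fun a x => c * (a == a0)%:R * (x == x0)%:R.

Lemma eff_unit c a x p : eff (unit_effect c a x) p = c * p a x.
Proof.
rewrite -(sum_delta a (fun a => c * p a x)); apply: eq_bigr => a' _.
rewrite -(sum_delta x (fun x => c * p a' x * (a' == a)%:R)); apply: eq_bigr => x' _.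
by rewrite /unit_effect; ring.
Qed.

(** Farkas' lemma with the coordinates as functionals, on the space [L] of no-signalling functions
    whose total does not depend on the input: a nonnegative element of [L] is a nonnegative multiple
    of a state, so [eff c] is nonnegative there. *)
Lemma effect_decomp (c : outs S -> ins S -> R) :
  (forall p, is_state p -> 0 <= eff c p) ->
  exists2 d : outs S -> ins S -> R, forall a x, 0 <= d a x &
    forall p, is_state p -> eff c p = eff d p.
Proof.
move=> c0; pose T := (outs S * ins S)%type.
pose cur (v : T -> R) a x := v (a, x).
pose L (v : T -> R) := nosig (cur v) /\
  forall x x', \sum_a cur v a x = \sum_a cur v a x'.
have [||||v [Lns Lsum] v0|u u0 uE] :=
  @farkas R T L T (enum {: T}) (fun i v => v i) (fun v => eff c (cur v)).
- move=> k p q [pns psum] [qns qsum]; split=> [b x x' xx' f fb|x x']; rewrite /cur.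
    under eq_bigr do rewrite mulrBr mulrCA; under [RHS]eq_bigr do rewrite mulrBr mulrCA.
    by rewrite !sumrB -!mulr_sumr (pns _ _ _ xx') // (qns _ _ _ xx').
  by rewrite !sumrB -!mulr_sumr [X in X - _](psum x x') [X in _ * X](qsum x x').
- exact: enum_uniq.
- by move=> i k p q _ _.
- move=> k p q _ _; rewrite -effZr /eff -sumrB; apply: eq_bigr => a _.
  by rewrite -sumrB; apply: eq_bigr => x _; rewrite -mulrBr.
- have /ustate_scale[q sq vE] : ustate (\sum_a cur v a (ins0 S)) (cur v).
    by split=> // a x; apply: v0; rewrite mem_enum.
  rewrite (_ : cur v = fun a x => (\sum_a cur v a (ins0 S)) * q a x); last first.
    by apply/funext => a; apply/funext => x; rewrite vE.
  rewrite effZr mulr_ge0 ?c0 // sumr_ge0 // => a _; apply: v0.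
  by rewrite mem_enum.
exists (fun a x => u (a, x)) => // p /is_stateE[p0 p1 pns].
rewrite -[p]/(cur (fun t => p t.1 t.2)) uE; last by split => // x x'; rewrite /cur /= !p1.
rewrite big_enum /= /eff pair_big /=.
by apply: eq_bigr => -[a x] _.
Qed.

(* Test against the deterministic state that outputs [a'] on [x'] and avoids [a]
   wherever the inputs differ. *)
Lemma extremal_effect d a a' x x' :
  0 < d -> (exists c, forall p, is_state p -> d * p a' x' <= c * p a x) ->
  forall p, is_state p -> p a' x' = p a x.
Proof.
move=> d0 [c dc].
(* [other] moves every output unless there is only one; by [otherE], a fixed point means that all
   outputs coincide. *)
pose other n (i : 'I_n.+1) : 'I_n.+1 := if i == ord0 then ord_max else ord0.
have otherE n (i j : 'I_n.+1) : other n i = i -> i = j.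
  case: n i j => [i j _|n i j]; first by rewrite !ord1.
  by rewrite /other; case: (eqVneq i ord0) => [-> /(congr1 val)|/eqP iN /esym].
pose phi b (y : 'I_(@nin S b).+1) := if y == x' b then a' b else other _ (a b).
have phix' : finfun (fun b => phi b (x' b)) = a'.
  by apply/ffunP => b; rewrite ffunE /phi eqxx.
(* The test state gives [a'] probability 1 on [x'], so by domination it must output [a] on [x]. *)
have /eqP phix : a == finfun (fun b => phi b (x b)).
  have /is_stateE := detstate_ustate R phi => /dc.
  rewrite /detstate phix' eqxx mulr1; case: eqP => // _.
  by rewrite mulr0 leNgt d0.
(* Hence a box whose inputs differ has a single output, and the indicator of [a] ignores it. *)
have aE b : x' b != x b -> other _ (a b) = a b.
  by rewrite [in RHS]phix ffunE /phi eq_sym => /negPf ->.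
have <- : a = a'.
  apply/ffunP => b; have [xb|/aE] := eqVneq (x' b) (x b); last exact: otherE.
  by rewrite phix ffunE /phi xb eqxx.
move=> p /is_stateE[_ _ ns].
have := @nosig_sum _ _ p x' x (fun a0 => (a0 == a)%:R) ns.
have sE y : \sum_a0 (a0 == a)%:R * p a0 y = p a y.
  by under eq_bigr do rewrite mulrC; rewrite sum_delta.
rewrite !sE; apply=> b /aE ab a1 a2 a12; congr (_ == _)%:R.
apply/ffunP => b'; have [->|] := eqVneq b' b; last exact: a12.
by rewrite -(otherE _ _ (a1 b) ab) -(otherE _ _ (a2 b) ab).
Qed.

Definition fine n (M : 'I_n -> outs S -> ins S -> R) :=
  forall r, exists2 c : R, 0 <= c <= 1 &
    exists a x, forall p, is_state p -> eff (M r) p = c * p a x.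

Lemma is_measP n (M : 'I_n -> outs S -> ins S -> R) :
  (forall r p, is_state p -> 0 <= eff (M r) p) ->
  (forall p, is_state p -> \sum_(r < n) eff (M r) p = 1) -> is_meas M.
Proof.
move=> M0 M1; split=> // r p ps; rewrite M0 //= -(M1 p ps) (bigD1 r) //= lerDl.
by apply: sumr_ge0 => *; apply: M0.
Qed.

(** Every elementary term of a refining effect is dominated by [c * p a x], hence by extremality is
    itself a multiple of [p a x]. *)
Lemma fine_max_informative n (M : 'I_n -> outs S -> ins S -> R) :
  is_meas M -> fine M -> max_informative M.
Proof.
move=> Mm Mf; split=> // n' N f [Ne _] Nref s.
have [c /andP[c0 _] [a [x cE]]] := Mf (f s).
have [|d d0 dE] := @effect_decomp (N s); first by move=> p /(Ne s)/andP[].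
have NM p : is_state p -> eff (N s) p <= c * p a x.
  move=> ps; rewrite -cE // (Nref _ _ ps) (bigD1 s) //= lerDl.
  by apply: sumr_ge0 => t _; have /andP[] := Ne t p ps.
have dle a' x' p : is_state p -> d a' x' * p a' x' <= c * p a x.
  move=> ps; apply: le_trans (NM p ps); rewrite dE // /eff (bigD1 a') //= (bigD1 x') //=.
  have [p0 _ _] := ps; rewrite -addrA lerDl addr_ge0 ?sumr_ge0 // => i _.
    exact: mulr_ge0.
  by rewrite sumr_ge0 // => j _; apply: mulr_ge0.
have dpE p : is_state p -> eff (N s) p = (\sum_a' \sum_x' d a' x') * p a x.
  move=> ps; rewrite dE // /eff mulr_suml; apply: eq_bigr => a' _.
  rewrite mulr_suml; apply: eq_bigr => x' _.
  have [->|dN0] := eqVneq (d a' x') 0; first by rewrite !mul0r.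
  have dgt0 : 0 < d a' x' by rewrite lt_def dN0 d0.
  by congr (_ * _); apply: (extremal_effect dgt0 _ ps); exists c => q; apply: dle.
exists ((\sum_a' \sum_x' d a' x') / c) => p ps; rewrite cE // mulrA.
(* For [c = 0] the chosen ratio is 0 by the convention on division, and domination makes the
   refining effect vanish. *)
have [c00|cN0] := eqVneq c 0; last by rewrite divfK // dpE.
have := NM p ps; rewrite c00 mul0r invr0 !mulr0 mul0r => N0.
by apply: le_anti; rewrite N0; have /andP[->] := Ne s p ps.
Qed.

(** Splitting all outcomes into their elementary terms is a refinement; since it is trivial, an
    outcome is a multiple of any of its nonzero terms. *)
Lemma max_informative_fine n (M : 'I_n -> outs S -> ins S -> R) :
  max_informative M -> fine M.
Proof.
move=> [[Me M1] Mmax] r.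
have /choice[d dP] : forall r, exists d : outs S -> ins S -> R,
    (forall a x, 0 <= d a x) /\ forall p, is_state p -> eff (M r) p = eff d p.
  move=> r'; have [|d d0 dE] := @effect_decomp (M r'); last by exists d.
  by move=> p /(Me r')/andP[].
pose J := ('I_n * (outs S * ins S))%type.
pose Nj (j : J) := unit_effect (d j.1 j.2.1 j.2.2) j.2.1 j.2.2.
pose N (s : 'I_#|{: J}|) := Nj (enum_val s).
pose f (s : 'I_#|{: J}|) := (enum_val s).1.
have Nsum (P : pred 'I_n) p : \sum_(s | P (f s)) eff (N s) p =
    \sum_(r' | P r') eff (d r') p.
  transitivity (\sum_(j : J | P j.1) eff (Nj j) p).
    rewrite [RHS](reindex (fun s : 'I_#|{: J}| => enum_val s)) //=.
    by apply: onW_bij; apply: enum_val_bij.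
  under [RHS]eq_bigr do rewrite /eff pair_big /=.
  rewrite [RHS]pair_big_dep /=; apply: eq_big => [j|[r' [a x]] _]; first by rewrite andbT.
  exact: eff_unit.
have Nref : refines_via N M f.
  by move=> r' p ps; rewrite (Nsum (pred1 r')) big_pred1_eq; apply: (dP r').2.
have Nm : is_meas N.
  apply: is_measP => [s p ps|p ps].
    rewrite eff_unit mulr_ge0 //; first exact: (dP _).1.
    by have [] := ps.
  by rewrite (Nsum xpredT) -(M1 p ps); apply: eq_bigr => r' _; rewrite (dP r').2.
have Ntriv := Mmax _ _ _ Nm Nref.
have [[a [x dN0]]|d0] := pselect (exists a x, d r a x != 0).
  have [k kE] := Ntriv (enum_rank (r, (a, x))).
  have {}kE p : is_state p -> d r a x * p a x = k * eff (M r) p.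
    by move=> /kE; rewrite /N /f !enum_rankK eff_unit.
  have [p ps pax] := exists_state R a x.
  have kN0 : k != 0.
    by apply: contra_neq dN0 => k0; have := kE p ps; rewrite pax k0 mulr1 mul0r.
  have ME q : is_state q -> eff (M r) q = d r a x / k * q a x.
    by move=> qs; rewrite mulrAC kE // mulrC mulKf.
  exists (d r a x / k); last by exists a, x.
  by have := Me r p ps; rewrite ME // pax mulr1.
(* Without a nonzero term the effect vanishes: weight 0 at an arbitrary position. *)
exists 0; first by rewrite lexx ler01.
exists (finfun (fun=> ord0)), (ins0 S) => p ps; rewrite mul0r (dP r).2 //.
rewrite /eff big1 // => a _; rewrite big1 // => x _.
have [->|dN0] := eqVneq (d r a x) 0; first by rewrite mul0r.
by case: d0; exists a, x.
Qed.

(** Chooses a weight and a position for each outcome; normalisation extends to unnormalised states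
    by homogeneity. *)
Lemma fine_ustate n (M : 'I_n -> outs S -> ins S -> R) : is_meas M -> fine M ->
  exists (c : 'I_n -> R) (a : 'I_n -> outs S) (x : 'I_n -> ins S),
  [/\ forall r, 0 <= c r <= 1,
      forall p, is_state p -> forall r, eff (M r) p = c r * p (a r) (x r) &
      forall k p, ustate k p -> \sum_r c r * p (a r) (x r) = k].
Proof.
move=> [_ M1] Mf.
have /choice[t tP] : forall r, exists t : R * (outs S * ins S), 0 <= t.1 <= 1 /\
    forall p, is_state p -> eff (M r) p = t.1 * p t.2.1 t.2.2.
  by move=> r; have [c c01 [a [x E]]] := Mf r; exists (c, (a, x)).
exists (fun r => (t r).1), (fun r => (t r).2.1), (fun r => (t r).2.2); split.
- by move=> r; have [] := tP r.
- by move=> p ps r; have [_ ->] := tP r.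
- move=> k p /ustate_scale[q qs pE]; rewrite -[RHS]mulr1 -(M1 q qs) mulr_sumr.
  by apply: eq_bigr => r _; have [_ ->//] := tP r; rewrite pE mulrCA.
Qed.

End Measurements.

(** * Shannon entropy *)

Section Entropy.
Variable R : realType.
Implicit Types x y z : R.

Lemma ln2_gt0 : 0 < ln 2 :> R.
Proof. by rewrite ln_gt0 // ltr1n. Qed.

Lemma negxlog2E x : negxlog2 x = - (x * ln x) / ln 2.
Proof. by rewrite /negxlog2; case: eqP => [->|_]; rewrite ?mul0r ?oppr0 ?mul0r // mulrA mulNr. Qed.

Lemma negxlog2_0 : negxlog2 0 = 0 :> R.
Proof. by rewrite /negxlog2 eqxx. Qed.

Lemma negxlog2_1 : negxlog2 1 = 0 :> R.
Proof. by rewrite negxlog2E ln1 mulr0 oppr0 mul0r. Qed.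

Lemma negxlog2_ge0 x : 0 <= x <= 1 -> 0 <= negxlog2 x.
Proof.
move=> /andP[x0 x1]; rewrite negxlog2E; apply: divr_ge0; last exact/ltW/ln2_gt0.
by rewrite oppr_ge0 mulr_ge0_le0 // ln_le0.
Qed.

Lemma negxlog2M x y : 0 <= x -> 0 <= y ->
  negxlog2 (x * y) = x * negxlog2 y + y * negxlog2 x.
Proof.
rewrite !le0r => /predU1P[->|x0]; first by rewrite !mul0r negxlog2_0 mulr0 addr0.
move=> /predU1P[->|y0]; first by rewrite mulr0 mul0r negxlog2_0 mulr0 addr0.
by rewrite !negxlog2E lnM // mulrDr; field; rewrite gt_eqF ?ln2_gt0.
Qed.

(** This is [ln u <= u - 1] at [u = y * z / x], multiplied by [x]. The bounds on [x] make [y] and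
    [z] positive when [x] is. *)
Lemma gibbs_pointwise x y z : 0 <= x -> x <= y -> x <= z ->
  - (x * ln x) <= - (x * ln y) - x * ln z + (y * z - x).
Proof.
rewrite le0r => /predU1P[-> y0 z0|x0 xy xz].
  by rewrite !mul0r !oppr0 !addr0 add0r mulr_ge0.
have y0 := lt_le_trans x0 xy; have z0 := lt_le_trans x0 xz.
have yzx : 0 < y * z / x by rewrite !(mulr_gt0, invr_gt0).
have : ln (y * z / x) <= y * z / x - 1.
  by rewrite -{1}[y * z / x](addrNK 1) addrC le_ln1Dx // ltrBrDl addrN.
rewrite ln_div ?lnM ?posrE ?mulr_gt0 // -(ler_pM2l x0) => h.
have xE : x * (y * z / x - 1) = y * z - x by field; rewrite gt_eqF.
by move: h; rewrite xE; lra.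
Qed.

(** Sums the pointwise inequality; the corrections [Q1 i * Q2 j - P i j] add up to zero. *)
Lemma shannon_subadditive (I J : finType) (P : I -> J -> R) (Q1 : I -> R) (Q2 : J -> R) :
  (forall i j, 0 <= P i j) -> (forall i, \sum_j P i j = Q1 i) ->
  (forall j, \sum_i P i j = Q2 j) -> \sum_i Q1 i = 1 ->
  \sum_i \sum_j negxlog2 (P i j) <= \sum_i negxlog2 (Q1 i) + \sum_j negxlog2 (Q2 j).
Proof.
move=> P0 PQ1 PQ2 Q1s.
have Q2s : \sum_j Q2 j = 1.
  by rewrite -Q1s -(eq_bigr _ (fun i _ => PQ1 i)) -(eq_bigr _ (fun j _ => PQ2 j)) exchange_big.
have PQ1le i j : P i j <= Q1 i by rewrite -PQ1 (bigD1 j) //= lerDl sumr_ge0.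
have PQ2le i j : P i j <= Q2 j by rewrite -PQ2 (bigD1 i) //= lerDl sumr_ge0.
have le1 : \sum_i \sum_j negxlog2 (P i j) <= \sum_i \sum_j
    ((- (P i j * ln (Q1 i)) - P i j * ln (Q2 j) + (Q1 i * Q2 j - P i j)) / ln 2).
  apply: ler_sum => i _; apply: ler_sum => j _; rewrite negxlog2E.
  by rewrite ler_pM2r ?invr_gt0 ?ln2_gt0 // gibbs_pointwise.
apply: (le_trans le1); under eq_bigr do rewrite -mulr_suml.
rewrite -mulr_suml (eq_bigr _ (fun i _ => negxlog2E (Q1 i))).
rewrite (eq_bigr _ (fun j _ => negxlog2E (Q2 j))) -!mulr_suml -mulrDl.
rewrite ler_pM2r ?invr_gt0 ?ln2_gt0 //.
have E i : \sum_j (- (P i j * ln (Q1 i)) - P i j * ln (Q2 j) + (Q1 i * Q2 j - P i j)) =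
    - (Q1 i * ln (Q1 i)) - \sum_j P i j * ln (Q2 j).
  by rewrite big_split /= !sumrB sumrN -mulr_suml PQ1 -mulr_sumr Q2s mulr1 subrr addr0.
rewrite (eq_bigr _ (fun i _ => E i)) sumrB lerD2l exchange_big /= -sumrN.
by apply: ler_sum => j _; rewrite -mulr_suml PQ2.
Qed.

Lemma shannon_prod (I J : finType) (P : I -> R) (Q : J -> R) :
  (forall i, 0 <= P i) -> (forall j, 0 <= Q j) -> \sum_i P i = 1 -> \sum_j Q j = 1 ->
  \sum_i \sum_j negxlog2 (P i * Q j) = \sum_i negxlog2 (P i) + \sum_j negxlog2 (Q j).
Proof.
move=> P0 Q0 P1 Q1; under eq_bigr do under eq_bigr do rewrite negxlog2M //.
under eq_bigr do rewrite big_split /= -mulr_sumr -mulr_suml Q1 mul1r.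
by rewrite big_split /= -mulr_suml P1 mul1r addrC.
Qed.

End Entropy.

(** * Bounds on the measurement entropy *)

Section EntropyBounds.
Variables (R : realType) (S : system).
Implicit Types (p g : outs S -> ins S -> R) (xi : outs S -> ins S).

(* The effects [p |-> p a (xi a)] form a measurement: [xi] feeds outputs of
   boxes into inputs of others without causal loops. *)
Definition wiring xi := forall p, is_state p -> \sum_a p a (xi a) = 1.

Lemma wiring_const x : wiring (fun=> x).
Proof. by move=> p [_ p1 _]; apply: p1. Qed.

Lemma wiring_max_informative xi : wiring xi ->
  max_informative (fun r : 'I_#|outs S| => unit_effect (1 : R) (enum_val r) (xi (enum_val r))).
Proof.
move=> w; apply: fine_max_informative.
  apply: is_measP => [r p [p0 _ _]|p ps]; first by rewrite eff_unit mul1r.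
  rewrite -[RHS](w p ps) [RHS](reindex (fun s : 'I_#|outs S| => enum_val s)) /=.
    by apply: eq_bigr => r _; rewrite eff_unit mul1r.
  by apply: onW_bij; apply: enum_val_bij.
move=> r; exists 1; first by rewrite ler01 lexx.
by exists (enum_val r), (xi (enum_val r)) => p _; rewrite eff_unit.
Qed.

Lemma H_M_ge0 n (M : 'I_n -> outs S -> ins S -> R) p :
  is_meas M -> is_state p -> 0 <= H_M M p.
Proof.
by move=> [Me _] ps; apply: sumr_ge0 => r _; apply: negxlog2_ge0; apply: Me.
Qed.

Lemma Hhat_le n (M : 'I_n -> outs S -> ins S -> R) p :
  max_informative M -> is_state p -> Hhat p <= H_M M p.
Proof.
move=> Mm ps; apply: ge_inf; last by exists n, M.
by exists 0 => _ [n' [M' [[M'm _] ->]]]; apply: H_M_ge0.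
Qed.

Lemma Hhat_ge_meas k p :
  (forall n (M : 'I_n -> outs S -> ins S -> R), max_informative M -> k <= H_M M p) ->
  k <= Hhat p.
Proof.
move=> H; apply: lb_le_inf.
  (* The infimum is over a nonempty set: reading every box at input 0 is maximally informative. *)
  by eexists; do 2!eexists; split; [exact: wiring_max_informative (wiring_const (ins0 S))|].
by move=> _ [n [M [Mm ->]]]; apply: H.
Qed.

Lemma Hhat_le_wiring xi p : wiring xi -> is_state p ->
  Hhat p <= \sum_a negxlog2 (p a (xi a)).
Proof.
move=> w ps; apply: (le_trans (Hhat_le (wiring_max_informative w) ps)).
rewrite [leRHS](reindex (fun s : 'I_#|outs S| => enum_val s)) /=; last first.
  by apply: onW_bij; apply: enum_val_bij.
by apply: ler_sum => r _; rewrite eff_unit mul1r.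
Qed.

(* A fine-grained outcome of weight [c] at [(a, x)] contributes at least
   [c * negxlog2 (p a x)], and these weights sum an unnormalised state to its norm. *)
Lemma Hhat_ge k g p : is_state p -> ustate k g ->
  (forall a x, g a x <= negxlog2 (p a x)) -> k <= Hhat p.
Proof.
move=> ps gk gp; apply: Hhat_ge_meas => n M Mm.
have [c [a [x [c01 ME Msum]]]] := fine_ustate Mm.1 (max_informative_fine Mm).
rewrite -(Msum _ _ gk); apply: ler_sum => r _; rewrite ME //.
have /andP[c0 c1] := c01 r; have [p0 _ _] := ps.
rewrite negxlog2M // ler_wpDr ?mulr_ge0 // ?negxlog2_ge0 ?c01 //.
exact: ler_wpM2l.
Qed.

Lemma Hhat_ge0 p : is_state p -> 0 <= Hhat p.
Proof. by move=> ps; apply: Hhat_ge_meas => n M [Mm _]; apply: H_M_ge0. Qed.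

End EntropyBounds.

(** * Composite systems and subadditivity *)

Section Composition.
Variables (R : realType) (X Y : system).
Let XY := compose X Y.

Definition fstO (c : outs XY) : outs X := finfun (fun b : box X => c (inl b)).
Definition sndO (c : outs XY) : outs Y := finfun (fun b : box Y => c (inr b)).
Definition fstI (z : ins XY) : ins X := finfun (fun b : box X => z (inl b)).
Definition sndI (z : ins XY) : ins Y := finfun (fun b : box Y => z (inr b)).

Lemma fstO_join a b : fstO (joinO a b) = a.
Proof. by apply/ffunP => i; rewrite !ffunE. Qed.
Lemma sndO_join a b : sndO (joinO a b) = b.
Proof. by apply/ffunP => i; rewrite !ffunE. Qed.
Lemma fstI_join x y : fstI (joinI x y) = x.
Proof. by apply/ffunP => i; rewrite !ffunE. Qed.
Lemma sndI_join x y : sndI (joinI x y) = y.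
Proof. by apply/ffunP => i; rewrite !ffunE. Qed.
Lemma joinO_proj c : joinO (fstO c) (sndO c) = c.
Proof. by apply/ffunP => -[i|i]; rewrite !ffunE. Qed.

Lemma sum_join (V : nmodType) (F : outs XY -> V) :
  \sum_c F c = \sum_a \sum_b F (joinO a b).
Proof.
rewrite pair_big /= (reindex (fun ab : outs X * outs Y => joinO ab.1 ab.2)) //=.
exists (fun c => (fstO c, sndO c)) => [[a b] _|c _] /=; last exact: joinO_proj.
by rewrite fstO_join sndO_join.
Qed.

Lemma agree_joinOl (b0 : box X) (a1 a2 : outs X) (b : outs Y) :
  agree_off b0 a1 a2 -> agree_off (inl b0 : box XY) (joinO a1 b) (joinO a2 b).
Proof. by move=> a12 [i|i] ib; rewrite !ffunE // a12. Qed.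
Lemma agree_joinOr (b0 : box Y) (a : outs X) (b1 b2 : outs Y) :
  agree_off b0 b1 b2 -> agree_off (inr b0 : box XY) (joinO a b1) (joinO a b2).
Proof. by move=> b12 [i|i] ib; rewrite !ffunE // b12. Qed.
Lemma agree_joinIl (b0 : box X) (x1 x2 : ins X) (y : ins Y) :
  agree_off b0 x1 x2 -> agree_off (inl b0 : box XY) (joinI x1 y) (joinI x2 y).
Proof. by move=> a12 [i|i] ib; rewrite !ffunE // a12. Qed.
Lemma agree_joinIr (b0 : box Y) (x : ins X) (y1 y2 : ins Y) :
  agree_off b0 y1 y2 -> agree_off (inr b0 : box XY) (joinI x y1) (joinI x y2).
Proof. by move=> b12 [i|i] ib; rewrite !ffunE // b12. Qed.

Definition prodstate (q : outs X -> ins X -> R) (r : outs Y -> ins Y -> R) :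
    outs XY -> ins XY -> R :=
  fun c z => q (fstO c) (fstI z) * r (sndO c) (sndI z).

Lemma prod_ustate k l q r : ustate k q -> ustate l r -> ustate (k * l) (prodstate q r).
Proof.
move=> [q0 q1 qns] [r0 r1 rns]; split=> [c z|z|[b|b] z z' zz' f fb].
- exact: mulr_ge0.
- rewrite sum_join -(q1 (fstI z)) mulr_suml; apply: eq_bigr => a _.
  rewrite -(r1 (sndI z)) mulr_sumr; apply: eq_bigr => b _.
  by rewrite /prodstate fstO_join sndO_join.
- have E y : \sum_c f c * prodstate q r c y = \sum_b' r b' (sndI y) *
      \sum_a f (joinO a b') * q a (fstI y).
    rewrite sum_join exchange_big; apply: eq_bigr => b' _; rewrite mulr_sumr.
    by apply: eq_bigr => a _; rewrite /prodstate fstO_join sndO_join; ring.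
  have zs : sndI z = sndI z' by apply/ffunP => i; rewrite !ffunE zz'.
  rewrite !E zs; apply: eq_bigr => b' _; congr (_ * _).
  apply: (qns b) => [i ib|a1 a2 a12]; first by rewrite !ffunE zz'.
  exact/fb/agree_joinOl.
- have E y : \sum_c f c * prodstate q r c y = \sum_a q a (fstI y) *
      \sum_b' f (joinO a b') * r b' (sndI y).
    rewrite sum_join; apply: eq_bigr => a _; rewrite mulr_sumr.
    by apply: eq_bigr => b' _; rewrite /prodstate fstO_join sndO_join; ring.
  have zs : fstI z = fstI z' by apply/ffunP => i; rewrite !ffunE zz'.
  rewrite !E zs; apply: eq_bigr => a _; congr (_ * _).
  apply: (rns b) => [i ib|a1 a2 a12]; first by rewrite !ffunE zz'.
  exact/fb/agree_joinOr.
Qed.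

Implicit Type p : outs XY -> ins XY -> R.

(** Turns a sum over one party into a joint expectation, to which the no-signalling condition of [p]
    applies. *)
Lemma slice_sumX p (b : outs Y) (f : outs X -> R) z :
  \sum_a f a * p (joinO a b) z = \sum_c (sndO c == b)%:R * f (fstO c) * p c z.
Proof.
rewrite sum_join; apply: eq_bigr => a _; rewrite (bigD1 b) //= big1 ?addr0.
  by rewrite sndO_join fstO_join eqxx mul1r.
by move=> b' /negPf b'b; rewrite sndO_join b'b !mul0r.
Qed.

Lemma slice_sumY p (a : outs X) (f : outs Y -> R) z :
  \sum_b f b * p (joinO a b) z = \sum_c (fstO c == a)%:R * f (sndO c) * p c z.
Proof.
rewrite sum_join (bigD1 a) //= [X in _ + X]big1 ?addr0 => [|a' /negPf a'a].
  by apply: eq_bigr => b _; rewrite sndO_join fstO_join eqxx mul1r.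
by rewrite big1 // => b _; rewrite fstO_join a'a !mul0r.
Qed.

(** The state of [X] conditioned on outcome [b] at input [y], left unnormalised; no-signalling for
    the boxes of [X] makes its norm independent of [x]. *)
Lemma slice_ustateX k p (b : outs Y) (y : ins Y) : ustate k p ->
  ustate (\sum_a p (joinO a b) (joinI (ins0 X) y)) (fun a x => p (joinO a b) (joinI x y)).
Proof.
move=> [p0 p1 ns]; split=> // [x|b0 x x' xx' f fb].
  have E x0 : \sum_a p (joinO a b) (joinI x0 y) =
      \sum_c (sndO c == b)%:R * 1 * p c (joinI x0 y).
    by rewrite -(slice_sumX _ _ (fun=> 1)); apply: eq_bigr => a _; rewrite mul1r.
  rewrite !E; apply: nosig_sum ns _ => -[i|i]; rewrite !ffunE ?eqxx // => _ c1 c2 c12.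
  congr (_%:R * _); congr (nat_of_bool (_ == _)); apply/ffunP => j.
  by rewrite !ffunE c12.
rewrite !slice_sumX; apply: (ns (inl b0)) => [|c1 c2 c12]; first exact: agree_joinIl.
congr (_ * _); last by apply: fb => j jb; rewrite !ffunE c12.
by congr (nat_of_bool (_ == _))%:R; apply/ffunP => j; rewrite !ffunE c12.
Qed.

Lemma slice_ustateY k p (a : outs X) (x : ins X) : ustate k p ->
  ustate (\sum_b p (joinO a b) (joinI x (ins0 Y))) (fun b y => p (joinO a b) (joinI x y)).
Proof.
move=> [p0 p1 ns]; split=> // [y|b0 y y' yy' f fb].
  have E y0 : \sum_b p (joinO a b) (joinI x y0) =
      \sum_c (fstO c == a)%:R * 1 * p c (joinI x y0).
    by rewrite -(slice_sumY _ _ (fun=> 1)); apply: eq_bigr => b _; rewrite mul1r.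
  rewrite !E; apply: nosig_sum ns _ => -[i|i]; rewrite !ffunE ?eqxx // => _ c1 c2 c12.
  congr (_%:R * _); congr (nat_of_bool (_ == _)); apply/ffunP => j.
  by rewrite !ffunE c12.
rewrite !slice_sumY; apply: (ns (inr b0)) => [|c1 c2 c12]; first exact: agree_joinIr.
congr (_ * _); last by apply: fb => j jb; rewrite !ffunE c12.
by congr (nat_of_bool (_ == _))%:R; apply/ffunP => j; rewrite !ffunE c12.
Qed.

Lemma redX_state p : is_state p -> is_state (redX p).
Proof.
move=> /is_stateE ps; apply/is_stateE.
apply: ustate_ext (ustate_sum (fun b => slice_ustateX b (ins0 Y) ps)) => //.
by rewrite exchange_big /= -(sum_join (fun c => p c _)); have [_ -> _] := ps.
Qed.

Lemma redY_state p : is_state p -> is_state (redY p).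
Proof.
move=> /is_stateE ps; apply/is_stateE.
apply: ustate_ext (ustate_sum (fun a => slice_ustateY a (ins0 X) ps)) => //.
by rewrite -(sum_join (fun c => p c _)); have [_ -> _] := ps.
Qed.

(** A product of elementary effects is elementary, so the product measurement is fine. Summing its
    law over one index measures a slice completely, so its marginals are the laws of [M] and [N]. *)
Lemma prod_meas m n (M : 'I_m -> outs X -> ins X -> R) (N : 'I_n -> outs Y -> ins Y -> R) p :
  max_informative M -> max_informative N -> is_state p ->
  exists l (L : 'I_l -> outs XY -> ins XY -> R), max_informative L /\
    H_M L p <= H_M M (redX p) + H_M N (redY p).
Proof.
move=> Mm Nm ps.
have [c [a [x [c01 ME Msum]]]] := fine_ustate Mm.1 (max_informative_fine Mm).
have [d [b [y [d01 NE Nsum]]]] := fine_ustate Nm.1 (max_informative_fine Nm).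
pose J := ('I_m * 'I_n)%type.
pose P q (i : 'I_m) (j : 'I_n) := c i * d j * q (joinO (a i) (b j)) (joinI (x i) (y j)).
have c0 i : 0 <= c i by have /andP[] := c01 i.
have d0 i : 0 <= d i by have /andP[] := d01 i.
have P0 q i j : is_state q -> 0 <= P q i j.
  by move=> [q0 _ _]; rewrite !mulr_ge0.
have PX q i : is_state q -> \sum_j P q i j = eff (M i) (redX q).
  move=> qs; rewrite (ME _ (redX_state qs)) /redX.
  have /is_stateE qu := qs; rewrite -(Nsum _ _ (slice_ustateY (a i) (x i) qu)).
  by rewrite mulr_sumr; apply: eq_bigr => j _; rewrite mulrA.
have PY q j : is_state q -> \sum_i P q i j = eff (N j) (redY q).
  move=> qs; rewrite (NE _ (redY_state qs)) /redY.
  have /is_stateE qu := qs; rewrite -(Msum _ _ (slice_ustateX (b j) (y j) qu)).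
  by rewrite mulr_sumr; apply: eq_bigr => i _; rewrite /P mulrCA mulrA.
have sumJ (V : nmodType) (F : 'I_m -> 'I_n -> V) :
    \sum_(s < #|{: J}|) F (enum_val s).1 (enum_val s).2 = \sum_i \sum_j F i j.
  rewrite pair_big /= [RHS](reindex (fun s : 'I_#|{: J}| => enum_val s)) //=.
  by apply: onW_bij; apply: enum_val_bij.
pose L (s : 'I_#|{: J}|) := let ij : J := enum_val s in
  unit_effect (c ij.1 * d ij.2) (joinO (a ij.1) (b ij.2)) (joinI (x ij.1) (y ij.2)).
have LE s q : eff (L s) q = P q (enum_val s).1 (enum_val s).2 by exact: eff_unit.
exists #|{: J}|, L; split.
  apply: fine_max_informative => [|s].
    apply: is_measP => [s q qs|q qs]; first by rewrite LE P0.
    under eq_bigr do rewrite LE; rewrite (sumJ _ (P q)).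
    under eq_bigr do rewrite PX //.
    exact: Mm.1.2 (redX_state qs).
  exists (c (enum_val s).1 * d (enum_val s).2).
    have /andP[c0' c1] := c01 (enum_val s).1; have /andP[d0' d1] := d01 (enum_val s).2.
    by rewrite mulr_ge0 ?mulr_ile1.
  by do 2!eexists; move=> q _; apply: eff_unit.
rewrite /H_M; under eq_bigr do rewrite LE.
rewrite (sumJ _ (fun i j => negxlog2 (P p i j))).
apply: shannon_subadditive => [i j|i|j|]; [exact: P0|exact: PX|exact: PY|].
exact: Mm.1.2 (redX_state ps).
Qed.

Lemma Hhat_subadditive p : is_state p -> Hhat p <= Hhat (redX p) + Hhat (redY p).
Proof.
move=> ps; rewrite -lerBlDr; apply: Hhat_ge_meas => m M Mm.
rewrite lerBlDr addrC -lerBlDr; apply: Hhat_ge_meas => n N Nm.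
have [l [L [Lm HL]]] := prod_meas Mm Nm ps.
by rewrite lerBlDr addrC (le_trans _ HL) // Hhat_le.
Qed.

End Composition.

(** * Systems of one box *)

Section SingleBox.
Variables (R : realType) (i o : nat).

Definition single : system := @Sys unit (fun=> i) (fun=> o).

Definition boxstate (k : 'I_o.+1 -> 'I_i.+1 -> R) : outs single -> ins single -> R :=
  fun a x => k (a tt) (x tt).

Definition single_out (j : 'I_o.+1) : outs single :=
  finfun (fun b => j : 'I_(@nout single b).+1).
Definition single_in (j : 'I_i.+1) : ins single :=
  finfun (fun b => j : 'I_(@nin single b).+1).

Lemma sum_single (V : nmodType) (F : 'I_o.+1 -> V) :
  \sum_(a : outs single) F (a tt) = \sum_j F j.
Proof.
rewrite (reindex single_out) /=.
  by apply: eq_bigr => j _; rewrite ffunE.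
exists (fun a : outs single => a tt) => [j _|a _]; first by rewrite ffunE.
by apply/ffunP => -[]; rewrite ffunE.
Qed.

(** With only one box, a function ignoring its output is constant, so no-signalling reduces to
    normalisation. *)
Lemma boxstate_ustate K k : (forall j x, 0 <= k j x) -> (forall x, \sum_j k j x = K) ->
  ustate K (boxstate k).
Proof.
move=> k0 k1; split=> [a x|x|[] x x' _ f fb]; first exact: k0.
  exact: etrans (sum_single (fun j => k j (x tt))) _.
have fE a : f a = f (single_out ord0) by apply: fb => -[].
have E z : \sum_a f a * boxstate k a z = f (single_out ord0) * K.
  under eq_bigr do rewrite fE.
  by rewrite -mulr_sumr (sum_single (fun j => k j (z tt))) k1.
by rewrite !E.
Qed.

End SingleBox.

(** * Output distributions for the example *)

Section Kernels.
Variable R : realType.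
Implicit Types (N : nat) (e : R).

(** The two distributions have disjoint supports, so the output reveals [j]. *)
Definition spread N (j : bool) (i : 'I_N.+1) : R :=
  if j then (i != ord0)%:R / N%:R else (i == ord0)%:R.

Definition bern e (j : bool) : R := if j then e else 1 - e.

(** The output law at input [y] when the hidden bit is Bernoulli with parameter [e]. *)
Definition mixspread e N (y : bool) (i : 'I_N.+1) : R :=
  \sum_(j : bool) bern e j * spread (j (+) y) i.

Definition log2 N : R := ln N%:R / ln 2.

Lemma log2_ge0 N : 0 <= log2 N.
Proof.
apply: divr_ge0; last exact/ltW/ln2_gt0.
by case: N => [|N]; [rewrite ln0 | rewrite ln_ge0 // ler1n].
Qed.

Lemma spread_ge0 N j (i : 'I_N.+1) : 0 <= spread j i.
Proof. by case: j; rewrite /spread ?ler0n // divr_ge0 // ler0n. Qed.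

Lemma spread_sum N j : (0 < N)%N -> \sum_(i < N.+1) spread j i = 1.
Proof.
move=> N0; rewrite big_ord_recl /spread; case: j => /=; last first.
  by rewrite big1 ?addr0 // => i _.
rewrite mul0r add0r sumr_const card_ord mul1r -[LHS]mulr_natr mulVf //.
by rewrite pnatr_eq0 -lt0n.
Qed.

Lemma spread_neq N j (i : 'I_N.+1) : j != (i != ord0) -> spread j i = 0.
Proof. by rewrite /spread; case: j; case: (i == ord0); rewrite //= ?mul0r. Qed.

Lemma bern_ge0 e j : 0 <= e <= 1 -> 0 <= bern e j.
Proof. by case/andP => e0 e1; case: j; rewrite /bern // subr_ge0. Qed.

Lemma sum_bool (F : bool -> R) : \sum_(j : bool) F j = F true + F false.
Proof. by rewrite big_bool. Qed.

Lemma bern_sum e : \sum_j bern e j = 1.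
Proof. by rewrite sum_bool /bern; ring. Qed.

Lemma mixspreadE e N y (i : 'I_N.+1) :
  mixspread e y i = bern e ((i != ord0) (+) y) * spread (i != ord0) i.
Proof.
rewrite /mixspread sum_bool /bern /spread.
by case: y; case: eqP => _ /=; ring.
Qed.

Lemma mixspread_ge0 e N y (i : 'I_N.+1) : 0 <= e <= 1 -> 0 <= mixspread e y i.
Proof. by move=> e01; rewrite mixspreadE mulr_ge0 ?bern_ge0 ?spread_ge0. Qed.

Lemma mixspread_sum e N y : (0 < N)%N -> \sum_(i < N.+1) mixspread e y i = 1.
Proof.
move=> N0; rewrite exchange_big /= -(bern_sum e); apply: eq_bigr => j _.
by rewrite -mulr_sumr spread_sum // mulr1.
Qed.

Lemma mixspread_le1 e N y (i : 'I_N.+1) : (0 < N)%N -> 0 <= e <= 1 -> mixspread e y i <= 1.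
Proof.
move=> N0 e01; rewrite -(mixspread_sum e y N0) (bigD1 i) //= lerDl sumr_ge0 // => k _.
exact: mixspread_ge0.
Qed.

Lemma negxlog2V N : negxlog2 (N%:R^-1 : R) = N%:R^-1 * log2 N.
Proof.
have [->|N0] := eqVneq N 0; first by rewrite invr0 negxlog2_0 mul0r.
by rewrite negxlog2E /log2 lnV ?posrE ?ltr0n ?lt0n // mulrN opprK mulrA.
Qed.

(** Chain rule: the entropy of the revealed bit, plus [log2 N] with probability [e]. *)
Lemma mixspread_entropy e N : (0 < N)%N -> 0 <= e <= 1 ->
  \sum_(i < N.+1) negxlog2 (mixspread e false i) =
  negxlog2 e + negxlog2 (1 - e) + e * log2 N.
Proof.
move=> N0 /andP[e0 e1]; rewrite big_ord_recl.
under eq_bigr do rewrite mixspreadE /= /spread /= mul1r negxlog2M ?invr_ge0 ?ler0n //.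
rewrite sumr_const card_ord negxlog2V mixspreadE /spread /= mulr1 -[X in _ + X = _]mulr_natr.
by field; rewrite pnatr_eq0 -lt0n N0.
Qed.

Lemma spread_entropy N : \sum_(i < N.+1) negxlog2 (spread false i) = 0.
Proof.
by apply: big1 => i _; rewrite /spread; case: eqP => _; rewrite ?negxlog2_0 ?negxlog2_1.
Qed.

(** A nonzero output has weight [e] or [1 - e], depending on [y]; as [e <= 2^-1], both are at least
    [e], so one bound serves both inputs. *)
Lemma mixspread_lower e N y (i : 'I_N.+1) : (0 < N)%N -> 0 <= e <= 2^-1 ->
  e * log2 N * spread true i <= negxlog2 (mixspread e y i).
Proof.
move=> N0 /andP[e0 e2].
have e01 : 0 <= e <= 1 by apply/andP; split => //; lra.
have [i0|iN] := eqVneq i ord0.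
  rewrite /spread i0 eqxx mul0r mulr0 negxlog2_ge0 //.
  by rewrite mixspread_ge0 // mixspread_le1.
rewrite mixspreadE /spread iN mul1r.
have b01 : 0 <= bern e (true (+) y) <= 1.
  by rewrite bern_ge0 //=; case: (y); rewrite /bern /=; lra.
have eb : e <= bern e (true (+) y) by case: (y); rewrite /bern /=; lra.
have /andP[b0 _] := b01.
rewrite negxlog2M ?invr_ge0 ?ler0n // negxlog2V -[leLHS]addr0 lerD //; last first.
  by rewrite mulr_ge0 ?invr_ge0 ?ler0n // negxlog2_ge0.
by rewrite -mulrA [X in e * X]mulrC ler_wpM2r // mulr_ge0 ?invr_ge0 ?ler0n ?log2_ge0.
Qed.

Lemma negxlog2_min_entropy (x : R) (N : nat) : 0 <= x -> (0 < N)%N -> x <= N%:R^-1 ->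
  log2 N * x <= negxlog2 x.
Proof.
rewrite le0r => /predU1P[->|x0] N0 xN; first by rewrite mulr0 negxlog2_0.
have N0' : 0 < N%:R :> R by rewrite ltr0n.
rewrite negxlog2E /log2 mulrAC ler_pM2r ?invr_gt0 ?ln2_gt0 // mulrC -mulrN.
rewrite ler_pM2l // -lnV ?posrE // ler_ln ?posrE ?invr_gt0 //.
by rewrite -[N%:R]invrK lef_pV2 ?posrE ?invr_gt0.
Qed.

End Kernels.

(** * The local states of the example *)

Section Example.
Variable R : realType.

(** The arguments of [single] are one below the numbers of inputs and outputs: the first box has two
    inputs, the second only one. *)
Definition party (N m : nat) : system := compose (single 1 N) (single 0 m).

(* The second box of a party outputs [spread m j]; its first box outputs
   [0] when its input equals [j'] and noise on [1..N] otherwise. *)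
Definition party_state (N m : nat) (j j' : bool) : outs (party N m) -> ins (party N m) -> R :=
  prodstate (boxstate (fun o (x : 'I_2) => spread R (j' (+) (x != ord0)) o))
            (boxstate (fun o (x : 'I_1) => spread R j o)).

Definition party_mix (e : R) (N m : nat) : outs (party N m) -> ins (party N m) -> R :=
  prodstate (boxstate (fun o (x : 'I_2) => mixspread e (x != ord0) o))
            (boxstate (fun o (x : 'I_1) => mixspread e false o)).

Lemma party_state_ustate N m j j' : (0 < N)%N -> (0 < m)%N -> ustate 1 (@party_state N m j j').
Proof.
move=> N0 m0; rewrite -[1]mulr1; apply: prod_ustate; apply: boxstate_ustate => *;
  by [apply: spread_ge0|apply: spread_sum].
Qed.

Lemma party_mix_ustate e N m : 0 <= e <= 1 -> (0 < N)%N -> (0 < m)%N ->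
  ustate 1 (@party_mix e N m).
Proof.
move=> e01 N0 m0; rewrite -[1]mulr1; apply: prod_ustate; apply: boxstate_ustate => *;
  by [apply: mixspread_ge0|apply: mixspread_sum].
Qed.

(** By the product rule for [negxlog2], the bounds for the two boxes combine into the unnormalised
    state in which one factor is a bound and the other the state of the other box. *)
Lemma party_mix_lower e N m : 0 <= e <= 2^-1 -> (0 < N)%N -> (0 < m)%N ->
  e * log2 R N + e * log2 R m <= Hhat (@party_mix e N m).
Proof.
move=> e02 N0 m0; have /andP[e0 e2] := e02.
have e01 : 0 <= e <= 1 by apply/andP; split => //; lra.
pose g1 := boxstate (fun (o : 'I_N.+1) (x : 'I_2) => e * log2 R N * spread R true o).
pose g2 := boxstate (fun (o : 'I_m.+1) (x : 'I_1) => e * log2 R m * spread R true o).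
have s1 : ustate 1 (boxstate (fun (o : 'I_N.+1) (x : 'I_2) => mixspread e (x != ord0) o)).
  by apply: boxstate_ustate => *; [apply: mixspread_ge0|apply: mixspread_sum].
have s2 : ustate 1 (boxstate (fun (o : 'I_m.+1) (x : 'I_1) => mixspread e false o)).
  by apply: boxstate_ustate => *; [apply: mixspread_ge0|apply: mixspread_sum].
have u1 : ustate (e * log2 R N) g1.
  apply: boxstate_ustate => *; first by do ?[exact: spread_ge0|exact: log2_ge0|apply: mulr_ge0].
  by rewrite -mulr_sumr spread_sum // mulr1.
have u2 : ustate (e * log2 R m) g2.
  apply: boxstate_ustate => *; first by do ?[exact: spread_ge0|exact: log2_ge0|apply: mulr_ge0].
  by rewrite -mulr_sumr spread_sum // mulr1.
have := ustateD (prod_ustate u1 s2) (prod_ustate s1 u2); rewrite mulr1 mul1r => ug.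
apply: Hhat_ge ug _; first exact/is_stateE/party_mix_ustate.
move=> a x; rewrite /party_mix /prodstate /boxstate negxlog2M ?mixspread_ge0 // addrC.
rewrite lerD //; first by rewrite ler_wpM2l ?mixspread_ge0 // mixspread_lower.
by rewrite mulrC ler_wpM2l ?mixspread_ge0 // mixspread_lower.
Qed.

(** Reading both boxes at input 0 gives two independent outputs. *)
Lemma party_mix_upper e N m : 0 <= e <= 1 -> (0 < N)%N -> (0 < m)%N ->
  Hhat (@party_mix e N m) <=
  e * log2 R N + e * log2 R m + 2 * (negxlog2 e + negxlog2 (1 - e)).
Proof.
move=> e01 N0 m0.
have /is_stateE ps := party_mix_ustate e01 N0 m0.
apply: (le_trans (Hhat_le_wiring (@wiring_const R _ (ins0 _)) ps)).
rewrite sum_join (_ : \sum_a _ = \sum_(i < N.+1) \sum_(j < m.+1)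
  negxlog2 (mixspread e false i * mixspread e false j)); last first.
  rewrite -(sum_single 1 (fun i => \sum_(j < m.+1)
    negxlog2 (mixspread e false i * mixspread e false j))); apply: eq_bigr => a _.
  rewrite -(sum_single 0 (fun j => negxlog2 (mixspread e false (a tt) * mixspread e false j))).
  apply: eq_bigr => b _; rewrite /party_mix /prodstate /boxstate fstO_join sndO_join.
  by rewrite /ins0 !ffunE.
rewrite shannon_prod => [|i|i||]; do ?[exact: mixspread_ge0|exact: mixspread_sum].
by rewrite !mixspread_entropy //; lra.
Qed.

End Example.

(** * The joint state of the example *)

Section Joint.
Variables (R : realType) (N m N' m' : nat).
Let XY := compose (party N m) (party N' m').
Implicit Types (w : bool -> bool -> R) (c : outs XY) (z : ins XY).

(** The bits are crossed: each party's own bit steers the first box of the other. *)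
Definition joint_branch (j j' : bool) : outs XY -> ins XY -> R :=
  prodstate (party_state R j j') (party_state R j' j).

(** The weights are left free because the lower bound uses the same branches, weighted by
    logarithms. *)
Definition joint w : outs XY -> ins XY -> R :=
  fun c z => \sum_(jj : bool * bool) w jj.1 jj.2 * joint_branch jj.1 jj.2 c z.

Lemma sum_bool2 (F : bool -> bool -> R) : \sum_(jj : bool * bool) F jj.1 jj.2 =
  F true true + F true false + (F false true + F false false).
Proof. by rewrite -(pair_big xpredT xpredT F) /= !sum_bool. Qed.

Lemma bern2_sum e : \sum_(jj : bool * bool) bern e jj.1 * bern e jj.2 = 1 :> R.
Proof. by rewrite (sum_bool2 (fun j j' => bern e j * bern e j')) /bern; ring. Qed.

Lemma joint_branch_ustate j j' : (0 < N)%N -> (0 < m)%N -> (0 < N')%N -> (0 < m')%N ->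
  ustate 1 (joint_branch j j').
Proof.
by move=> *; rewrite -[1]mulr1; apply: prod_ustate; apply: party_state_ustate.
Qed.

Lemma joint_ustate w : (0 < N)%N -> (0 < m)%N -> (0 < N')%N -> (0 < m')%N ->
  (forall j j', 0 <= w j j') -> ustate (\sum_(jj : bool * bool) w jj.1 jj.2) (joint w).
Proof.
move=> N0 m0 N'0 m'0 w0; apply: ustate_sum => -[j j'].
apply: ustate_ext (ustateZ (w0 j j') (joint_branch_ustate j j' N0 m0 N'0 m'0)) => //.
exact: mulr1.
Qed.

Definition bitX c : bool := sndO (fstO c) tt != ord0.
Definition bitY c : bool := sndO (sndO c) tt != ord0.

(* The branches have disjoint supports, as the second outputs reveal the bits. *)
Lemma jointE w c z : joint w c z = w (bitX c) (bitY c) * joint_branch (bitX c) (bitY c) c z.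
Proof.
rewrite /joint (bigD1 (bitX c, bitY c)) //= big1 ?addr0 // => -[j j'] /= jN.
rewrite /joint_branch /prodstate /party_state /prodstate /boxstate.
have [jX|jX] := eqVneq j (bitX c); last by rewrite (spread_neq R jX) !(mulr0, mul0r).
have [jY|jY] := eqVneq j' (bitY c); last by rewrite (spread_neq R jY) !(mulr0, mul0r).
by rewrite jX jY eqxx in jN.
Qed.

Lemma joint_separable e : 0 <= e <= 1 -> (0 < N)%N -> (0 < m)%N -> (0 < N')%N -> (0 < m')%N ->
  separable (joint (fun j j' => bern e j * bern e j')).
Proof.
move=> e01 N0 m0 N'0 m'0; pose J := (bool * bool)%type.
have sumJ (F : J -> R) : \sum_(s < #|{: J}|) F (enum_val s) = \sum_jj F jj.
  rewrite [RHS](reindex (fun s : 'I_#|{: J}| => enum_val s)) //=.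
  by apply: onW_bij; apply: enum_val_bij.
exists #|{: J}|, (fun s => let jj : J := enum_val s in bern e jj.1 * bern e jj.2).
exists (fun s => let jj : J := enum_val s in party_state R jj.1 jj.2).
exists (fun s => let jj : J := enum_val s in party_state R jj.2 jj.1); split.
- by move=> s; rewrite mulr_ge0 ?bern_ge0.
- by rewrite (sumJ (fun jj => bern e jj.1 * bern e jj.2)) bern2_sum.
- by move=> s; apply/is_stateE/party_state_ustate.
- by move=> s; apply/is_stateE/party_state_ustate.
move=> a b x y; rewrite /joint -sumJ; apply: eq_bigr => s _.
by rewrite /joint_branch /prodstate !fstO_join !sndO_join !fstI_join !sndI_join mulrA.
Qed.

(** Each box depends on only one of the two independent bits, so the mixture factorises. *)
Lemma sum_party_state e n l (a : outs (party n l)) x :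
  \sum_(jj : bool * bool) bern e jj.1 * bern e jj.2 * party_state R jj.1 jj.2 a x =
  party_mix e a x.
Proof.
rewrite (sum_bool2 (fun j j' => bern e j * bern e j' * party_state R j j' a x)).
rewrite /party_mix /party_state /prodstate /boxstate /mixspread !sum_bool /=.
by ring.
Qed.

Lemma redX_joint e : (0 < N')%N -> (0 < m')%N ->
  redX (joint (fun j j' => bern e j * bern e j')) = party_mix e (N := N) (m := m).
Proof.
move=> N'0 m'0; apply/funext => a; apply/funext => x.
rewrite /redX /joint exchange_big -sum_party_state; apply: eq_bigr => -[j j'] _ /=.
rewrite -mulr_sumr; congr (_ * _).
have [_ r1 _] := party_state_ustate R j' j N'0 m'0.
rewrite -[RHS]mulr1 -(r1 (ins0 _)) mulr_sumr; apply: eq_bigr => b _.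
by rewrite /joint_branch /prodstate !fstO_join !sndO_join !fstI_join !sndI_join.
Qed.

Lemma redY_joint e : (0 < N)%N -> (0 < m)%N ->
  redY (joint (fun j j' => bern e j * bern e j')) = party_mix e (N := N') (m := m').
Proof.
move=> N0 m0; apply/funext => b; apply/funext => y.
rewrite /redY /joint exchange_big -sum_party_state.
(* For the second party the own bit is [j'], so the bits are swapped. *)
rewrite [RHS](reindex (fun jj : bool * bool => (jj.2, jj.1))) /=; last first.
  by exists (fun jj => (jj.2, jj.1)) => -[].
apply: eq_bigr => -[j j'] _ /=.
rewrite -mulr_sumr [bern e j' * _]mulrC; congr (_ * _).
have [_ r1 _] := party_state_ustate R j j' N0 m0.
rewrite -[RHS]mul1r -(r1 (ins0 _)) mulr_suml; apply: eq_bigr => a _.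
by rewrite /joint_branch /prodstate !fstO_join !sndO_join !fstI_join !sndI_join.
Qed.

Lemma spread_le n j (i : 'I_n.+1) : spread R j i <= (if j then n else 1)%:R^-1.
Proof.
rewrite /spread; case: j; last by rewrite invr1 lern1 leq_b1.
by rewrite ler_piMl ?invr_ge0 ?ler0n // lern1 leq_b1.
Qed.

Lemma spread_le1 n j (i : 'I_n.+1) : (0 < n)%N -> spread R j i <= 1.
Proof.
move=> n0; apply: le_trans (spread_le j i) _.
by rewrite invf_le1 ?ler1n ?ltr0n; case: j.
Qed.

(** A min-entropy bound: outputs revealing bits [j] and [j'] have probability at most the inverse of
    [k j m * k j' m'], whatever the inputs. The first boxes are bounded by 1. *)
Lemma joint_lower e : 0 <= e <= 1 -> (0 < N)%N -> (0 < m)%N -> (0 < N')%N -> (0 < m')%N ->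
  e * log2 R m + e * log2 R m' <= Hhat (joint (fun j j' => bern e j * bern e j')).
Proof.
move=> e01 N0 m0 N'0 m'0.
(* The number of values over which a second box with bit [j] is uniform. *)
pose k (j : bool) n := (if j then n else 1)%N.
have k0 j n : (0 < n)%N -> (0 < k j n)%N by case: j.
have log2k j n : log2 R (k j n) = j%:R * log2 R n.
  by case: j; rewrite /k ?mul1r // mul0r /log2 ln1 mul0r.
pose w j j' := bern e j * bern e j' * (log2 R (k j m) + log2 R (k j' m')).
have w0 j j' : 0 <= w j j' by rewrite !mulr_ge0 ?addr_ge0 ?bern_ge0 ?log2_ge0.
have b0 j j' : 0 <= bern e j * bern e j' by rewrite mulr_ge0 ?bern_ge0.
have sw : \sum_(jj : bool * bool) w jj.1 jj.2 = e * log2 R m + e * log2 R m'.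
  by rewrite (sum_bool2 w) /w !log2k /bern /=; ring.
have /is_stateE js : ustate 1 (joint (fun j j' => bern e j * bern e j')).
  by rewrite -(bern2_sum e); apply: joint_ustate.
have := joint_ustate N0 m0 N'0 m'0 w0; rewrite sw => jw.
apply: (Hhat_ge js jw) => c z.
set p := joint (fun j j' => bern e j * bern e j'); set j := bitX c; set j' := bitY c.
have -> : joint w c z = log2 R (k j m * k j' m') * p c z.
  have -> : log2 R (k j m * k j' m') = log2 R (k j m) + log2 R (k j' m').
    by rewrite /log2 natrM lnM ?posrE ?ltr0n ?k0 // mulrDl.
  rewrite /p !jointE -/j -/j' /w; ring.
apply: negxlog2_min_entropy; [by have [] := js|by rewrite muln_gt0 !k0|].
rewrite /p jointE -/j -/j' natrM invfM.
have bern1 i : bern e i <= 1 by have /andP[? ?] := e01; case: i; rewrite /bern //; lra.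
have sp0 := spread_ge0 R.
rewrite -[leRHS]mul1r ler_pM ?mulr_ile1 ?bern_ge0 //.
  by have [+ _ _] := joint_branch_ustate j j' N0 m0 N'0 m'0; apply.
have ps0 n l i i' a x : (0 < n)%N -> (0 < l)%N -> 0 <= @party_state R n l i i' a x.
  by move=> n0 l0; have [+ _ _] := party_state_ustate R i i' n0 l0; apply.
have psle n l i i' a x : (0 < n)%N -> @party_state R n l i i' a x <= (k i l)%:R^-1.
  move=> n0; rewrite /party_state /prodstate /boxstate -[leRHS]mul1r.
  by apply: ler_pM; [exact: sp0|exact: sp0|exact: spread_le1|exact: spread_le].
by apply: ler_pM; [exact: ps0|exact: ps0|exact: psle|exact: psle].
Qed.

(** Here [b] and [b'] are the bits of the first and second party; each first box is fed the bit of
    the other party. *)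
Definition adaptive_inputs (b b' : bool) : ins XY :=
  joinI (joinI (single_in N (if b' then ord_max else ord0 : 'I_2)) (ins0 (single 0 m)))
        (joinI (single_in N' (if b then ord_max else ord0 : 'I_2)) (ins0 (single 0 m'))).

(** On the outputs revealing given bits the inputs are constant. The indicator of these outputs
    ignores the first boxes, so no-signalling allows their inputs to be reset to 0. *)
Lemma adaptive_wiring : wiring R (fun c => adaptive_inputs (bitX c) (bitY c)).
Proof.
move=> p /is_stateE[_ p1 ns].
have E c z : p c z = \sum_(bb : bool * bool) ((bitX c, bitY c) == bb)%:R * p c z.
  rewrite -mulr_suml -[LHS]mul1r; congr (_ * _).
  rewrite -[LHS](sum_delta (bitX c, bitY c) (fun=> 1)).
  by apply: eq_bigr => bb _; rewrite mul1r eq_sym.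
rewrite -[RHS](p1 (adaptive_inputs false false)).
under eq_bigr do rewrite E; under [RHS]eq_bigr do rewrite E.
rewrite exchange_big [RHS]exchange_big; apply: eq_bigr => -[b b'] _ /=.
transitivity (\sum_c ((bitX c, bitY c) == (b, b'))%:R * p c (adaptive_inputs b b')).
  by apply: eq_bigr => c _; case: eqP => [[-> ->]//|]; rewrite !mul0r.
apply: nosig_sum => // -[[[]|[]]|[[]|[]]]; rewrite !ffunE ?eqxx // => _ c1 c2 c12.
  by congr (nat_of_bool (_ == _))%:R; rewrite /bitX /bitY !ffunE !c12.
by congr (nat_of_bool (_ == _))%:R; rewrite /bitX /bitY !ffunE !c12.
Qed.

Lemma party_entropy e n l : 0 <= e <= 1 -> (0 < l)%N ->
  \sum_(a : outs (party n l)) negxlog2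
    (spread R false (fstO a tt) * mixspread e false (sndO a tt)) =
  negxlog2 e + negxlog2 (1 - e) + e * log2 R l.
Proof.
move=> e01 l0; transitivity (\sum_(i < n.+1) \sum_(j < l.+1)
    negxlog2 (spread R false i * mixspread e false j)).
  rewrite sum_join -(sum_single 1 (fun i => \sum_(j < l.+1)
    negxlog2 (spread R false i * mixspread e false j))); apply: eq_bigr => a _.
  rewrite -(sum_single 0 (fun j => negxlog2 (spread R false (a tt) * mixspread e false j))).
  by apply: eq_bigr => b _; rewrite fstO_join sndO_join.
rewrite shannon_prod => [|i|i||].
- by rewrite spread_entropy add0r mixspread_entropy.
- exact: spread_ge0.
- exact: mixspread_ge0.
- rewrite big_ord_recl big1 ?addr0 // => i _.
- exact: mixspread_sum.
Qed.

(** The input of each first box cancels the bit that steers it, which makes its output 0 for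
    certain. *)
Lemma adaptive_joint e c :
  joint (fun j j' => bern e j * bern e j') c (adaptive_inputs (bitX c) (bitY c)) =
  (spread R false (fstO (fstO c) tt) * mixspread e false (sndO (fstO c) tt)) *
  (spread R false (fstO (sndO c) tt) * mixspread e false (sndO (sndO c) tt)).
Proof.
have inE (b : bool) : ((if b then ord_max else ord0 : 'I_2) != ord0) = b by case: b.
rewrite jointE /joint_branch /prodstate /party_state /prodstate /boxstate /adaptive_inputs.
rewrite !fstI_join !sndI_join !fstI_join !ffunE !inE !addbb !mixspreadE !addbF.
rewrite /bitX /bitY !ffunE; ring.
Qed.

Lemma joint_upper e : 0 <= e <= 1 -> (0 < N)%N -> (0 < m)%N -> (0 < N')%N -> (0 < m')%N ->
  Hhat (joint (fun j j' => bern e j * bern e j')) <=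
  e * log2 R m + e * log2 R m' + 2 * (negxlog2 e + negxlog2 (1 - e)).
Proof.
move=> e01 N0 m0 N'0 m'0.
have /is_stateE js : ustate 1 (joint (fun j j' => bern e j * bern e j')).
  rewrite -(bern2_sum e); apply: joint_ustate => // j j'.
  by rewrite mulr_ge0 ?bern_ge0.
apply: (le_trans (Hhat_le_wiring adaptive_wiring js)).
under eq_bigr do rewrite adaptive_joint.
pose P n l (a : outs (party n l)) := spread R false (fstO a tt) * mixspread e false (sndO a tt).
have P0 n l a : 0 <= @P n l a by rewrite mulr_ge0 ?spread_ge0 ?mixspread_ge0.
have P1 n l : (0 < n)%N -> (0 < l)%N -> \sum_a @P n l a = 1.
  move=> n0 l0.
  have [_ + _] := prod_ustate (boxstate_ustate (i := 0) (fun j _ => spread_ge0 R false j)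
    (fun _ => spread_sum R false n0)) (boxstate_ustate (i := 0)
    (fun j _ => mixspread_ge0 false j e01) (fun _ => mixspread_sum e false l0)).
  by move=> /(_ (ins0 _)); rewrite mulr1.
rewrite sum_join (_ : \sum_a _ = \sum_a \sum_b negxlog2 (@P N m a * @P N' m' b)); last first.
  by do 2!apply: eq_bigr => ? _; rewrite /P !fstO_join !sndO_join.
rewrite shannon_prod ?P1 // !party_entropy //; lra.
Qed.

End Joint.

(** * Choice of parameters and density *)

(** Writing the probability as a square gives a bound linear in [t], since [- ln t <= t^-1 - 1]
    loses only one factor of [t]. *)
Lemma negxlog2_bound (R : realType) (t : R) : 0 < t <= 1 ->
  negxlog2 (t ^+ 2) + negxlog2 (1 - t ^+ 2) <= 3 * t / ln 2.
Proof.
move=> /andP[t0 t1]; rewrite !negxlog2E -mulrDl ler_pM2r ?invr_gt0 ?ln2_gt0 //.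
have lnt : - ln t <= t^-1 - 1.
  rewrite -lnV ?posrE // -{1}[t^-1](addrNK 1) addrC le_ln1Dx //.
  by rewrite ltrBrDl addrN invr_gt0.
have h1 : - (t ^+ 2 * ln (t ^+ 2)) <= 2 * t.
  rewrite lnXn // (_ : - _ = 2 * t ^+ 2 * - ln t); last by ring.
  apply: (@le_trans _ _ (2 * t ^+ 2 * (t^-1 - 1))).
    by apply: ler_wpM2l => //; rewrite mulr_ge0 // exprn_ge0 // ltW.
  rewrite (_ : _ * _ = 2 * t - 2 * t ^+ 2); last by field; rewrite gt_eqF.
  by rewrite gerDl oppr_le0 mulr_ge0 // exprn_ge0 // ltW.
have h2 : - ((1 - t ^+ 2) * ln (1 - t ^+ 2)) <= t ^+ 2.
  (* The boundary case relies on [ln] being 0 at nonpositive arguments. *)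
  have [e0|e0] := leP (1 - t ^+ 2) 0.
    rewrite ln0 // mulr0 oppr0 exprn_ge0 // ltW //.
  have : - ln (1 - t ^+ 2) <= (1 - t ^+ 2)^-1 - 1.
    rewrite -lnV ?posrE // -{1}[(1 - t ^+ 2)^-1](addrNK 1) addrC le_ln1Dx //.
    by rewrite ltrBrDl addrN invr_gt0.
  rewrite -(ler_pM2l e0) mulrBr mulfV ?gt_eqF //; lra.
have : t ^+ 2 <= t by rewrite expr2 ler_piMl // ltW.
lra.
Qed.

(** Takes the integer part of 2 to the power [g / e]; rounding at most halves the number, costing
    one bit, that is [e] after scaling. *)
Lemma exists_log2 (R : realType) (e g : R) : 0 < e -> 0 <= g ->
  exists2 n : nat, (0 < n)%N & g - e <= e * log2 R n <= g.
Proof.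
move=> e0 g0; pose y := expR (g / e * ln 2).
have l2 := ln2_gt0 R.
have ge0 : 0 <= g / e * ln 2 by rewrite mulr_ge0 ?divr_ge0 // ltW.
have y1 : 1 <= y by apply: le_trans (expR_ge1Dx _); rewrite lerDl.
have y0 : 0 < y := lt_le_trans ltr01 y1.
have n0 : (0 < Num.truncn y)%N by rewrite truncn_gt0.
have /andP[ny yn] := truncn_itv (ltW y0).
have n0' : 0 < (Num.truncn y)%:R :> R by rewrite ltr0n.
exists (Num.truncn y) => //.
have lny : ln y = g / e * ln 2 by rewrite /y expRK.
have -> : g = e * (ln y / ln 2) by rewrite lny; field; rewrite !gt_eqF.
rewrite /log2 -{2}[e]mulr1 -mulrBr !ler_pM2l //; apply/andP; split; last first.
  by rewrite ler_pM2r ?invr_gt0 // ler_ln ?posrE.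
rewrite (_ : _ - 1 = (ln y - ln 2) / ln 2); last by field; rewrite gt_eqF.
rewrite ler_pM2r ?invr_gt0 //.
rewrite lerBlDr -lnM ?posrE // ler_ln ?posrE ?mulr_gt0 //.
apply: le_trans (ltW yn) _; rewrite -natrM ler_nat; lia.
Qed.

Lemma sep_entropy_vectors_dense (R : realType) (a b c d : R) :
  0 <= a -> 0 <= b -> 0 <= c -> c <= a + b -> 0 < d ->
  exists a' b' c', [/\ sep_entropy_vectors (a', b', c'),
    `|a - a'| < d, `|b - b'| < d & `|c - c'| < d].
Proof.
move=> a0 b0 c0 cab d0; have l2 := ln2_gt0 R.
(* The three bounds give [e <= 2^-1], rounding errors of at most [d / 8] each, and
   [3 * t / ln 2 <= d / 4] for the entropies of the bits. *)
pose t := Num.min (2^-1 : R) (Num.min (d / 4) (d * ln 2 / 12)).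
have t0 : 0 < t by rewrite !lt_min invr_gt0 ltr0n !divr_gt0 ?mulr_gt0.
have [t2 td tdl] : [/\ t <= 2^-1, t <= d / 4 & t <= d * ln 2 / 12].
  by rewrite /t; split; rewrite ?ge_min ?lexx ?orbT.
pose e := t ^+ 2.
have e0 : 0 < e by rewrite exprn_gt0.
have et : e <= 2^-1 * t by rewrite /e expr2 ler_wpM2r // ltW.
have e2 : 0 <= e <= 2^-1 by apply/andP; split; [exact: ltW|lra].
have e01 : 0 <= e <= 1 by apply/andP; split; [exact: ltW|lra].
have he : 2 * (negxlog2 e + negxlog2 (1 - e)) <= d / 2.
  have t01 : 0 < t <= 1 by rewrite t0 /=; lra.
  have := negxlog2_bound t01; rewrite -/e => h.
  have : 3 * t / ln 2 <= d / 4 by rewrite ler_pdivrMr //; lra.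
  lra.
have he0 : 0 <= negxlog2 e + negxlog2 (1 - e).
  by rewrite addr_ge0 ?negxlog2_ge0 //; apply/andP; split; lra.
(* The joint entropy [c] is split into [g] and [c - g], carried by the second boxes; [c <= a + b]
   ensures [c - g <= b]. The first boxes supply the local remainders [a - g] and [b - (c - g)]. *)
pose g := Num.min a c.
have [ga gc g0 gb] : [/\ g <= a, g <= c, 0 <= g & c - g <= b].
  rewrite /g; split; rewrite ?ge_min ?lexx ?orbT ?le_min ?a0 ?c0 //.
  by case: (leP a c) => _; lra.
have [N N0 /andP[N1 N2]] := @exists_log2 R e (a - g) e0 ltac:(lra).
have [m m0 /andP[m1 m2]] := @exists_log2 R e g e0 g0.
have [N' N'0 /andP[N'1 N'2]] := @exists_log2 R e (b - (c - g)) e0 ltac:(lra).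
have [m' m'0 /andP[m'1 m'2]] := @exists_log2 R e (c - g) e0 ltac:(lra).
pose p := @joint R N m N' m' (fun j j' => bern e j * bern e j').
have ps : is_state p.
  apply/is_stateE; rewrite -(bern2_sum e); apply: joint_ustate => // j j'.
  by rewrite mulr_ge0 ?bern_ge0.
exists (Hhat (redX p)), (Hhat (redY p)), (Hhat p); split.
- exists (party N m), (party N' m'), p; split=> //; split=> //.
  exact: joint_separable.
- have := party_mix_lower e2 N0 m0; have := party_mix_upper e01 N0 m0.
  by rewrite /p redX_joint // ltr_norml => h1 h2; apply/andP; split; lra.
- have := party_mix_lower e2 N'0 m'0; have := party_mix_upper e01 N'0 m'0.
  by rewrite /p redY_joint // ltr_norml => h1 h2; apply/andP; split; lra.
- have := joint_lower e01 N0 m0 N'0 m'0; have := joint_upper e01 N0 m0 N'0 m'0.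
  by rewrite -/p ltr_norml => h1 h2; apply/andP; split; lra.
Qed.

Theorem theorem7 (R : realType) (X Y : system)
    (p : outs (compose X Y) -> ins (compose X Y) -> R) :
  is_state p -> closure (@sep_entropy_vectors R) (entvec p).
Proof.
move=> ps B /nbhs_ballP[d /= d0 dB].
have [a [b [c [sv ad bd cd]]]] := sep_entropy_vectors_dense
  (Hhat_ge0 (redX_state ps)) (Hhat_ge0 (redY_state ps)) (Hhat_ge0 ps)
  (Hhat_subadditive ps) d0.
by exists (a, b, c); split=> //; apply: dB; split; [split|].
Qed.
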